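(* There exists a finite tournament $T$ with minimum out-degree $\delta^+(T)=5$ that has exactly one vertex $x$ of out-degree $\delta^+(T)$, and this vertex $x$ is not a Seymour vertex of $T$ (and hence is not a strong Seymour vertex of $T$).
   Context: A tournament is an orientation of a complete graph. For a digraph $D$ with arc set $A(D)$ and a vertex $v$, $N_D^+(v)=\{y:(v,y)\in A(D)\}$ is the set of out-neighbors, $d_D^+(v)=|N_D^+(v)|$ is the out-degree, and $\delta^+(D)$ is the minimum out-degree over all vertices. The second out-neighborhood of $v$ is $$N^{++}_D(v)=\{z\in V(D)\setminus (N_D^+(v)\cup\{v\}) : (v,y),(y,z)\in A(D)\text{ for some }y\in N_D^+(v)\}.$$ A vertex $v$ is a Seymour vertex of $D$ if $|N^{++}_D(v)|\ge |N^+_D(v)|$. It is a strong Seymour vertex of $D$ if there is a complete matching from $N^+_D(v)$ to $N^{++}_D(v)$, i.e. a set of arcs of $D$ with tails in $N^+_D(v)$ and heads in $N^{++}_D(v)$, no two sharing an endpoint, such that every vertex of $N^+_D(v)$ is the tail of one of them. *)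

(* Defs.v *)
From mathcomp Require Import all_boot.

Set Implicit Arguments.
Unset Strict Implicit.
Unset Printing Implicit Defensive.

(* A finite digraph is a relation [e : rel T] on its vertex type [T : finType];
   [e u v] means that (u, v) is an arc. *)
Section Digraph.
Variables (T : finType) (e : rel T).

Definition tournament : Prop :=
  irreflexive e /\ forall u v : T, u != v -> e u v (+) e v u.

Definition out_nbhd (v : T) : {set T} := [set y | e v y].

Definition out_degree (v : T) : nat := #|out_nbhd v|.

(* Out-degrees never exceed #|T|, so the default value of the iterated minimum
   only matters for the digraph without vertices. *)
Definition min_out_degree : nat := \big[minn/#|T|]_(v : T) out_degree v.

Definition second_out_nbhd (v : T) : {set T} :=
  [set z in ~: (v |: out_nbhd v) | [exists y in out_nbhd v, e y z]].

Definition seymour_vertex (v : T) : Prop :=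
  #|out_nbhd v| <= #|second_out_nbhd v|.

Definition complete_matching (A B : {set T}) (M : {set T * T}) : Prop :=
  [/\ forall a, a \in M -> [/\ e a.1 a.2, a.1 \in A & a.2 \in B],
      forall a b, a \in M -> b \in M -> a != b ->
        [disjoint [set a.1; a.2] & [set b.1; b.2]]
    & forall y, y \in A -> exists2 a, a \in M & a.1 = y].

Definition strong_seymour_vertex (v : T) : Prop :=
  exists M : {set T * T}, complete_matching (out_nbhd v) (second_out_nbhd v) M.

End Digraph.

(* Main.v *)
Require Import Defs.
From mathcomp Require Import all_boot.

Set Implicit Arguments.
Unset Strict Implicit.
Unset Printing Implicit Defensive.

(** Let [V = {x} + A + B + C] with [|A| = 5], [|B| = 4] and [|C| = 5], and let
    all arcs between distinct blocks go [x -> A -> B -> C -> A], [B -> x] and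
    [C -> x].  Then [x] has out-neighbourhood [A] and second out-neighbourhood
    [B], so it is not a Seymour vertex.  If [A] is the regular tournament on
    five vertices, each vertex of [A] has out-degree [2 + 4]; each vertex of [B]
    has out-degree at least [|C| + 1] and each vertex of [C] at least [|A| + 1].
    A complete matching injects the out-neighbourhood into the second
    out-neighbourhood, so strong Seymour vertices are Seymour vertices. *)

Lemma complete_matching_leq_card (T : finType) (e : rel T) (A B : {set T})
    (M : {set T * T}) : complete_matching e A B M -> #|A| <= #|B|.
Proof.
case=> arcM disjM coverA.
have injM : {in M &, injective (fun a : T * T => a.2)}.
  (* Distinct arcs of [M] are disjoint, so they cannot share a head. *)
  move=> a b aM bM ab2; apply/eqP; apply: contraT => /(disjM _ _ aM bM).
  by move/pred0P/(_ a.2); rewrite /= !inE ab2 eqxx !orbT.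
have sub1 : A \subset [set a.1 | a in M].
  by apply/subsetP=> y /coverA[a aM <-]; apply: imset_f.
have sub2 : [set a.2 | a in M] \subset B.
  by apply/subsetP=> _ /imsetP[a /arcM[_ _ aB] ->].
apply: leq_trans (subset_leq_card sub2); rewrite (card_in_imset injM).
exact: leq_trans (subset_leq_card sub1) (leq_imset_card _ _).
Qed.

Lemma strong_seymour_vertex_seymour (T : finType) (e : rel T) (v : T) :
  strong_seymour_vertex e v -> seymour_vertex e v.
Proof. by case=> M; apply: complete_matching_leq_card. Qed.

Lemma min_out_degree_eq (T : finType) (e : rel T) (x : T) :
  (forall v, out_degree e x <= out_degree e v) ->
  min_out_degree e = out_degree e x.
Proof.
move=> min_x; apply/eqP; rewrite eqn_leq; apply/andP; split.
  rewrite /min_out_degree; have := mem_index_enum x.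
  elim: (index_enum T) => // y s IHs; rewrite inE big_cons geq_min.
  by case/predU1P=> [<-|/IHs->]; rewrite ?leqnn ?orbT.
(* The default value [#|T|] also bounds the out-degree of [x] from above. *)
rewrite /min_out_degree; elim/big_ind: _ => // [|m n xm xn].
  exact: max_card.
by rewrite leq_min xm.
Qed.

(** Turns cardinals of finite sets into counts that evaluate by computation. *)
Lemma card_ord_count (n : nat) (p : pred nat) :
  #|[set i : 'I_n | p i]| = count p (iota 0 n).
Proof.
rewrite cardsE cardE /enum_mem size_filter -enumT -val_enum_ord count_map.
exact: eq_count.
Qed.

Lemma all_iota_ord (n : nat) (p : pred nat) :
  all p (iota 0 n) -> forall i : 'I_n, p i.
Proof. by move=> /allP pn i; apply: pn; rewrite mem_iota /=. Qed.

(* The vertices are [x = 0], [A = 1..5], [B = 6..9] and [C = 10..14]. *)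
Definition block (i : nat) : nat := (0 < i) + (5 < i) + (9 < i).

Definition block_arc (p q : nat) : bool :=
  (p, q) \in [:: (0, 1); (1, 2); (2, 3); (3, 1); (2, 0); (3, 0)].

(** [A] is the circulant tournament on the residues mod 5 with steps 1 and 2; adding 5 avoids
    truncated subtraction. [B] and [C] are transitive. *)
Definition arc (i j : nat) : bool :=
  if block i != block j then block_arc (block i) (block j)
  else if block i == 1 then (j + 5 - i) %% 5 \in [:: 1; 2]
  else i < j.

Definition arc15 : rel 'I_15 := fun i j => arc i j.

Lemma arc15_tournament : tournament arc15.
Proof.
split=> [i|i j].
  by apply/negbTE; apply: (@all_iota_ord 15 (fun i => ~~ arc i i)).
have ij : all (fun i => all (fun j => (i != j) ==> arc i j (+) arc j i)
                          (iota 0 15)) (iota 0 15) by [].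
exact: (implyP (all_iota_ord (all_iota_ord ij i) j)).
Qed.

Lemma out_degree_arc15 (i : 'I_15) :
  out_degree arc15 i = count (arc i) (iota 0 15).
Proof. exact: card_ord_count. Qed.

Lemma out_degree_arc15_0 : out_degree arc15 ord0 = 5.
Proof. by rewrite out_degree_arc15. Qed.

Lemma out_degree_arc15_gt5 (i : 'I_15) : i != ord0 -> 5 < out_degree arc15 i.
Proof.
rewrite out_degree_arc15; apply/implyP.
exact: (@all_iota_ord 15 (fun i => (i != 0) ==> (5 < count (arc i) (iota 0 15)))).
Qed.

Lemma card_second_out_nbhd_arc15_0 : #|second_out_nbhd arc15 ord0| <= 4.
Proof.
have card_B : #|[set i : 'I_15 | block i == 2]| = 4.
  by rewrite (card_ord_count 15 (fun i => block i == 2)).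
rewrite -[leqRHS]card_B; apply/subset_leq_card/subsetP=> z.
rewrite !inE negb_or => /andP[/andP[z0 z1] /existsP[y /andP[]]].
rewrite inE => y1 yz.
(* Exhaustive check that two-step paths from [x] to new vertices end in [B]. *)
have paths : all (fun y => all (fun z =>
    [&& z != 0, ~~ arc 0 z, arc 0 y & arc y z] ==> (block z == 2))
    (iota 0 15)) (iota 0 15) by [].
by apply: (implyP (all_iota_ord (all_iota_ord paths y) z)); apply/and4P; split.
Qed.

Theorem mainTheorem4 :
  exists (T : finType) (e : rel T),
    [/\ tournament e,
        min_out_degree e = 5
      & exists x : T,
          [/\ [set v | out_degree e v == min_out_degree e] = [set x],
              ~ seymour_vertex e x
            & ~ strong_seymour_vertex e x]].
Proof.
have min5 : min_out_degree arc15 = 5.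
  rewrite (@min_out_degree_eq _ _ ord0) out_degree_arc15_0 // => v.
  have [->|/out_degree_arc15_gt5/ltnW //] := eqVneq v ord0.
  by rewrite out_degree_arc15_0.
have not_seymour : ~ seymour_vertex arc15 ord0.
  rewrite /seymour_vertex -[#|out_nbhd _ _|]/(out_degree arc15 ord0).
  rewrite out_degree_arc15_0 => /leq_trans/(_ card_second_out_nbhd_arc15_0).
  by [].
exists 'I_15, arc15; split=> //; first exact: arc15_tournament.
exists ord0; split=> //; last by move/strong_seymour_vertex_seymour.
apply/setP=> v; rewrite !inE min5.
have [->|/out_degree_arc15_gt5 v5] := eqVneq v ord0.
  by rewrite out_degree_arc15_0.
by rewrite gtn_eqF.
Qed.
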